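(* Let $G$ be a finite simple $2$-edge connected graph and let $C$ be a cycle of odd length in $G$. Then every edge $e \in E(G) \setminus E(C)$ is contained in a circuit of even length in $G$.
   Context: Graphs are finite, simple (no loops, no multiple edges). A graph is $2$-edge connected if it is connected and remains connected whenever fewer than $2$ edges are removed. A walk is a sequence $v_0, e_1, v_1, \ldots, e_k, v_k$ of vertices and edges with $e_i$ having endpoints $v_{i-1}, v_i$; a trail is a walk with no repeated edge; a circuit is a trail whose first and last vertices coincide (vertices may repeat). The length of a cycle or circuit is its number of edges; it is even or odd according to this length. *)

(* Defs.v *)
(* World: MathComp. *)
From mathcomp Require Import all_boot.

Set Implicit Arguments.
Unset Strict Implicit.
Unset Printing Implicit Defensive.

(* A finite simple graph is a symmetric irreflexive relation e on a finType T;
   its edges are the two-element sets {x, y} of adjacent vertices. *)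
Definition simple_graph (T : finType) (e : rel T) : Prop :=
  symmetric e /\ irreflexive e.

Definition edge_set (T : finType) (e : rel T) : {set {set T}} :=
  [set [set xy.1; xy.2] | xy : T * T & e xy.1 xy.2].

Definition delete_edges (T : finType) (e : rel T) (F : {set {set T}}) : rel T :=
  [rel x y | e x y && ([set x; y] \notin F)].

Definition connected_graph (T : finType) (e : rel T) : Prop :=
  forall x y : T, connect e x y.

Definition edge_connected (k : nat) (T : finType) (e : rel T) : Prop :=
  connected_graph e /\
  forall F : {set {set T}}, F \subset edge_set e -> #|F| < k ->
    connected_graph (delete_edges e F).

(* A walk v_0, e_1, v_1, ..., e_k, v_k is given by x = v_0 and
   p = [:: v_1; ...; v_k] with [path e x p]: as the graph is simple, e_i is
   determined as {v_(i-1), v_i}. Its length, the number of edges, is size p. *)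
Definition walk_edges (T : finType) (x : T) (p : seq T) : seq {set T} :=
  pairmap (fun u v : T => [set u; v]) x p.

Definition is_trail (T : finType) (e : rel T) (x : T) (p : seq T) : bool :=
  path e x p && uniq (walk_edges x p).

Definition is_circuit (T : finType) (e : rel T) (x : T) (p : seq T) : bool :=
  is_trail e x p && (last x p == x).

(* In a closed walk v_0 = v_k is the last item of p, so uniq p says that
   v_1, ..., v_k are distinct. Such a nonempty circuit has length at least 3:
   there are no loops, and x, y, x repeats an edge. *)
Definition is_cycle (T : finType) (e : rel T) (x : T) (p : seq T) : bool :=
  [&& is_circuit e x p, p != [::] & uniq p].

(* Main.v *)
Require Import Defs.
From mathcomp Require Import all_boot.

(** Call a pair of edge-disjoint trails from a vertex [w] to [C], both avoiding
    the edges of [C], a fork at [w]. If there is a fork at [w] and [wv] is an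
    edge outside [C], there is also a fork at [w] using [wv]: otherwise, leave
    [w] by [wv], follow a path avoiding [wv] (there is one by 2-edge
    connectivity) until it first meets the fork or [C], then the fork. Hence by
    connectivity there is a fork through every edge outside [C]. It is a trail
    between two vertices of [C], which are joined by two complementary arcs of
    [C]; as [C] is odd, one of them closes the trail into an even circuit. *)

Lemma uniq_countP (S : eqType) (s : seq S) :
  reflect (forall z, count_mem z s <= 1) (uniq s).
Proof.
apply: (iffP idP) => [Us z|le1]; first by rewrite count_uniq_mem //; case: (_ \in _).
apply: count_mem_uniq => z; have := le1 z; rewrite -has_pred1 has_count.
by case: (count_mem z s) => [|[]].
Qed.

Section Walks.
Variables (T : finType) (e : rel T).
Implicit Types (x y w z : T) (p q : seq T) (E : {set T}).

Definition rev_walk x p : seq T := rev (belast x p).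

Lemma last_rev_walk x p : last (last x p) (rev_walk x p) = x.
Proof. by case: p => //= y p; rewrite /rev_walk /= rev_cons last_rcons. Qed.

Lemma size_rev_walk x p : size (rev_walk x p) = size p.
Proof. by rewrite size_rev size_belast. Qed.

Lemma path_rev_walk x p :
  symmetric e -> path e x p -> path e (last x p) (rev_walk x p).
Proof. by move=> sym_e; rewrite rev_path; apply: sub_path => u v; rewrite sym_e. Qed.

Lemma walk_edges_cat x p q :
  walk_edges x (p ++ q) = walk_edges x p ++ walk_edges (last x p) q.
Proof. exact: pairmap_cat. Qed.

Lemma walk_edges_rev x p :
  walk_edges (last x p) (rev_walk x p) = rev (walk_edges x p).
Proof.
elim: p x => //= y p IHp x.
rewrite rev_cons -IHp /rev_walk /= rev_cons -[rcons (rev _) x]cats1 walk_edges_cat.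
by rewrite (last_rev_walk y p) /= cats1 setUC.
Qed.

Lemma mem_walk_edges x p E z :
  E \in walk_edges x p -> z \in E -> z \in x :: p.
Proof.
elim: p x => //= y p IHp x; rewrite !inE => /orP[/eqP->|/IHp H].
  by rewrite !inE orbA => ->.
by move=> /H; rewrite inE => ->; rewrite orbT.
Qed.

Lemma walk_edges_belast x p E :
  E \in walk_edges x p -> exists2 z, z \in belast x p & z \in E.
Proof.
elim: p x => //= y p IHp x; rewrite inE => /orP[/eqP->|/IHp[z zp zE]].
  by exists x; rewrite ?set21 ?mem_head.
by exists z => //; rewrite inE zp orbT.
Qed.

Lemma uniq_walk_edges x p : uniq (x :: p) -> uniq (walk_edges x p).
Proof.
elim: p x => // y p IHp x /= /andP[xNyp /IHp ->]; rewrite andbT.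
by apply: contra xNyp => /mem_walk_edges; apply; rewrite set21.
Qed.

Lemma delete_edges_walk (D : {set {set T}}) x p :
  path (delete_edges e D) x p -> forall E, E \in walk_edges x p -> E \notin D.
Proof.
elim: p x => //= y p IHp x /andP[/andP[_ xyND] /IHp pND] E.
by rewrite inE => /orP[/eqP->|/pND].
Qed.

Lemma split_first_hit (a : {pred T}) x p : last x p \in a ->
  exists q r, [/\ p = q ++ r, last x q \in a &
                  forall z, z \in belast x q -> z \notin a].
Proof.
elim: p x => [|y p IHp] x; first by exists [::], [::].
case: (boolP (x \in a)) => [ax _|xNa /IHp[q [r [-> lastq qNa]]]].
  by exists [::], (y :: p).
by exists (y :: q), r; split=> //= z; rewrite inE => /orP[/eqP->|/qNa].
Qed.

(* Here [B] and [F] stand for the vertices and the edges of [C]. *)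
Definition fork (B : {pred T}) (F : seq {set T}) w (P Q : seq T) : Prop :=
  [/\ path e w P, path e w Q, last w P \in B, last w Q \in B &
      uniq (walk_edges w P ++ walk_edges w Q ++ F)].

Section Forks.
Variables (B : {pred T}) (F : seq {set T}).
Hypothesis F_sub : forall E z, E \in F -> z \in E -> z \in B.

Lemma fork_sym w P Q : fork B F w P Q -> fork B F w Q P.
Proof. by case=> eP eQ BP BQ U; split=> //; rewrite uniq_catCA. Qed.

Lemma fork_shift w P Q z : symmetric e -> fork B F w P Q ->
  z \in (w :: P) ++ (w :: Q) -> exists P' Q', fork B F z P' Q'.
Proof.
move=> sym_e; wlog zP : P Q / z \in w :: P => [th|] fPQ.
  rewrite mem_cat => /orP[] zPQ; first by apply: (th P Q) => //; rewrite mem_cat zPQ.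
  by apply: (th Q P) (fork_sym _ _ _ fPQ) _ => //; rewrite mem_cat zPQ.
move=> _; case/splitPl: zP fPQ => P1 P2 <- [].
rewrite cat_path last_cat walk_edges_cat => /andP[eP1 eP2] eQ BP BQ U.
exists P2, (rev_walk w P1 ++ Q); split=> //.
- by rewrite cat_path last_rev_walk path_rev_walk.
- by rewrite last_cat last_rev_walk.
apply/uniq_countP => E; move/uniq_countP/(_ E): U.
by rewrite walk_edges_cat walk_edges_rev last_rev_walk !count_cat count_rev -!addnA addnCA.
Qed.

Lemma fork_through w P Q v : edge_connected 2 e ->
  fork B F w P Q -> e w v -> [set w; v] \notin F ->
  exists P' Q', fork B F w P' Q' /\
    [set w; v] \in walk_edges w P' ++ walk_edges w Q'.
Proof.
move=> [_ conn2] fPQ ewv vNF.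
case: (boolP ([set w; v] \in walk_edges w P ++ walk_edges w Q)) => [|vNPQ].
  by exists P, Q.
pose e' := delete_edges e [set [set w; v]].
have [R [eR UR lastR]] : exists R, [/\ path e' v R, uniq (v :: R) & last v R = w].
  have /connectP[R0 eR0 ->]: connect e' v w.
    apply: conn2; rewrite ?cards1 // sub1set.
    by apply/imsetP; exists (w, v); rewrite ?inE.
  by case/shortenP: eR0 => R eR UR _; exists R.
pose a := [pred z | (z \in (w :: P) ++ (w :: Q)) || (z \in B)].
have aw : last v R \in a by rewrite lastR inE mem_head.
have [R1 [R2 [defR aR1 NaR1]]] := split_first_hit a v R aw.
move: eR UR; rewrite defR cat_path -cat_cons cat_uniq.
move=> /andP[eR1 _] /andP[UR1 _].
have eR1' : path e v R1 by apply: sub_path eR1 => y z /andP[].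
have U1 : uniq (walk_edges w (v :: R1)).
  rewrite /= uniq_walk_edges // andbT.
  by apply/negP => /(delete_edges_walk _ _ _ eR1); rewrite inE eqxx.
have dis E : E \in walk_edges w (v :: R1) ->
    E \notin walk_edges w P ++ walk_edges w Q ++ F.
  rewrite inE catA mem_cat negb_or => /orP[/eqP->|/walk_edges_belast[z /NaR1]].
    by rewrite vNPQ vNF.
  rewrite inE negb_or mem_cat negb_or => /andP[/andP[zNP zNQ] zNB] zE.
  rewrite mem_cat negb_or -andbA; apply/and3P; split.
  - by apply: contra zNP => /mem_walk_edges; apply.
  - by apply: contra zNQ => /mem_walk_edges; apply.
  - by apply: contra zNB => /F_sub; apply.
have U E : count_mem E (walk_edges w (v :: R1)) +
    count_mem E (walk_edges w P ++ walk_edges w Q ++ F) <= 1.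
  have [_ _ _ _ /uniq_countP U2] := fPQ.
  case: (boolP (E \in walk_edges w (v :: R1))) => [/dis|] /count_memPn ->.
    by rewrite addn0; apply/uniq_countP.
  exact: U2.
have meets P' Q' : fork B F w P' Q' -> last v R1 \in w :: P' ->
    perm_eq (walk_edges w P' ++ walk_edges w Q' ++ F)
            (walk_edges w P ++ walk_edges w Q ++ F) ->
  exists P' Q', fork B F w P' Q' /\
    [set w; v] \in walk_edges w P' ++ walk_edges w Q'.
  move=> fPQ' zP' /permP Ecount; move: fPQ' Ecount.
  case/splitPl: zP' => P1 P2 lastP1 [].
  rewrite cat_path last_cat walk_edges_cat lastP1.
  move=> /andP[_ eP2] eQ' BP2 BQ' _ Ecount.
  exists (v :: R1 ++ P2), Q'; split; last by rewrite mem_head.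
  split=> //; first by rewrite /= ewv cat_path eR1' eP2.
    by rewrite /= last_cat.
  apply/uniq_countP => E; apply: leq_trans (U E); rewrite -Ecount.
  by rewrite -cat_cons walk_edges_cat !count_cat -[leqLHS]addnA leq_add2l leq_add2r leq_addl.
move: aR1; rewrite inE mem_cat -orbA => /or3P[zP|zQ|zB].
- exact: meets fPQ zP (perm_refl _).
- by apply: meets (fork_sym _ _ _ fPQ) zQ _; rewrite perm_catCA.
exists (v :: R1), Q; split; last by rewrite mem_head.
have [eP eQ BP BQ _] := fPQ; split=> //; first by rewrite /= ewv.
apply/uniq_countP => E; apply: leq_trans (U E).
by rewrite !count_cat leq_add2l leq_addl.
Qed.

Lemma connect_fork x w : symmetric e -> edge_connected 2 e ->
  uniq F -> x \in B -> exists P Q, fork B F w P Q.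
Proof.
move=> sym_e G2 UF Bx; have [connG _] := G2.
have fork_nil z : z \in B -> fork B F z [::] [::] by split.
have /connectP[s es ->] := connG x w.
have: exists P Q, fork B F x P Q by exists [::], [::]; apply: fork_nil.
elim: s x es {Bx} => //= v s IHs x /andP[exv es] [P [Q fPQ]]; apply: IHs es _.
case: (boolP ([set x; v] \in F)) => [vF|vNF].
  by exists [::], [::]; apply: fork_nil; apply: F_sub vF _; rewrite set22.
have [P' [Q' [fPQ']]] := fork_through _ _ _ _ G2 fPQ exv vNF.
move=> vPQ; apply: fork_shift sym_e fPQ' _.
by move: vPQ; rewrite !mem_cat => /orP[] /mem_walk_edges ->; rewrite ?set22 ?orbT.
Qed.

End Forks.

Lemma odd_circuit_arc x p u v (b : bool) : symmetric e ->
  is_circuit e x p -> odd (size p) -> u \in p -> v \in p ->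
  exists q, [/\ path e u q, last u q = v, odd (size q) = b &
    forall E, count_mem E (walk_edges u q) <= count_mem E (walk_edges x p)].
Proof.
move=> sym_e; rewrite /is_circuit /is_trail => /andP[/andP[ep _] /eqP lastp] oddp up vp.
have [c [ec lastc oddc vc Ec]] : exists c, [/\ path e u c, last u c = u,
    odd (size c), v \in c &
    forall E, count_mem E (walk_edges u c) = count_mem E (walk_edges x p)].
  have: u \in x :: p by rewrite inE up orbT.
  move=> xup; case/splitPl: xup ep lastp oddp vp {up} => p1 p2 lastp1.
  rewrite cat_path last_cat walk_edges_cat lastp1 => /andP[ep1 ep2] lastp2 oddp vp.
  exists (p2 ++ p1); rewrite cat_path last_cat walk_edges_cat lastp2 ep1 ep2.
  split=> //; first by rewrite size_cat addnC -size_cat.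
    by rewrite mem_cat orbC -mem_cat.
  by move=> E; rewrite !count_cat addnC.
have: v \in u :: c by rewrite inE vc orbT.
move=> uvc; case/splitPl: uvc ec lastc oddc Ec {vc} => c1 c2 lastc1.
rewrite cat_path last_cat walk_edges_cat lastc1 size_cat oddD.
move=> /andP[ec1 ec2] lastc2 oddc Ec.
have [oddc1|Noddc1] := eqVneq (odd (size c1)) b.
  by exists c1; split=> // E; rewrite -Ec count_cat leq_addr.
have := path_rev_walk v c2 sym_e ec2; have := last_rev_walk v c2.
have := walk_edges_rev v c2; rewrite lastc2 => Er lastr pathr.
exists (rev_walk v c2); split=> //.
  by rewrite size_rev_walk; case: b (odd _) (odd _) Noddc1 oddc => [] [] [].
by move=> E; rewrite -Ec Er count_rev count_cat leq_addl.
Qed.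

End Walks.

Theorem theorem6 (T : finType) (e : rel T)
    (G_simple : simple_graph e) (G_2conn : edge_connected 2 e)
    (x : T) (p : seq T) (C_cycle : is_cycle e x p) (C_odd : odd (size p))
    (f : {set T}) (f_edge : f \in edge_set e) (f_notC : f \notin walk_edges x p) :
  exists (y : T) (q : seq T),
    [/\ is_circuit e y q, ~~ odd (size q) & f \in walk_edges y q].
Proof.
have /and3P[circ_p _ _] := C_cycle.
have /andP[/andP[ep Up] /eqP lastp] := circ_p.
have xp : x \in p.
  case: p C_odd lastp {ep Up C_cycle circ_p f_notC} => //= y p _ <-.
  exact: mem_last.
have F_sub E z : E \in walk_edges x p -> z \in E -> z \in p.
  by move=> Ep /(mem_walk_edges _ _ _ _ _ Ep); rewrite inE => /orP[/eqP->|].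
have /imsetP[[w v] /= ewv deff] := f_edge; rewrite inE /= in ewv.
rewrite deff in f_notC.
have [P0 [Q0 fPQ0]] := connect_fork _ _ _ _ F_sub x w G_simple.1 G_2conn Up xp.
have [P [Q [[eP eQ BP BQ U] fPQ]]] :=
  fork_through _ _ _ _ F_sub _ _ _ _ G_2conn fPQ0 ewv f_notC.
have [A [eA lastA oddA cA]] := odd_circuit_arc _ _ x p (last w Q) (last w P)
  (odd (size P + size Q)) G_simple.1 circ_p C_odd BQ BP.
have eW := walk_edges_rev _ w P.
exists (last w P), (rev_walk _ w P ++ Q ++ A); split.
- rewrite /is_circuit /is_trail !last_cat !cat_path last_rev_walk lastA eqxx andbT.
  rewrite path_rev_walk ?eQ ?eA //=; last exact: G_simple.1.
  apply/uniq_countP => E; move/uniq_countP/(_ E): U; apply: leq_trans.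
  by rewrite !walk_edges_cat last_rev_walk eW !count_cat count_rev !leq_add2l cA.
- by rewrite !size_cat size_rev_walk addnA oddD oddA addbb.
by rewrite deff !walk_edges_cat last_rev_walk eW catA mem_cat mem_cat mem_rev -mem_cat fPQ.
Qed.
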